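(* Under the setting and assumptions stated in the context, let $u^\dagger$ be a solution of $A^*u=f$. Then: (a) There exists $v^n\in H_n$ such that $u^n\in (\partial\|\cdot\|_1)^{-1}(Av^n)$, i.e. $Av^n\in\partial\|\cdot\|_1(u^n)$. (b) The identity $\|u^n\|_1=\langle v^n,f^\delta\rangle$ holds, where $v^n$ is chosen as in (a). If $H_n\subseteq H_{n+1}$, then $\|u^n\|_1\leq \|u^{n+1}\|_1$. (c) Let $d_{ME}(n)= \frac{\langle v^{n+1}-v^n,f^\delta\rangle}{\|v^{n+1}-v^n\|}$ if $v^{n+1}\neq v^n$ and $d_{ME}(n)=0$ otherwise. Then $D(u^\dagger,u^{n+1})-D(u^\dagger,u^n)\leq -(d_{ME}(n)-\delta)\|v^{n+1}-v^n\|$, and, in case $v^{n+1}\neq v^n$, $d_{ME}(n)=\frac{\|u^{n+1}\|_1-\|u^n\|_1}{\|v^{n+1}-v^n\|}$, where the Bregman distances $D(u^\dagger,u^{n+1})$ and $D(u^\dagger,u^n)$ are taken with respect to the subgradients $\xi^{n+1}=Av^{n+1}$ and $\xi^n=Av^n$, respectively. Additionally, if $H_n\subseteq H_{n+1}$, then $d_{ME}(n)=\frac{D(u^{n+1},u^n)}{\|v^{n+1}-v^n\|}\geq 0$, and the error measured in the Bregman distance is monotonically decreasing as long as $\delta\leq d_{ME}(n)$. (d) Let $H_n\subseteq H_{n+1}$ hold for all $n\in\mathbb N$ and let $n_{ME}(\delta)=\min\{n\in\mathbb N:\ v^{n+1}\neq v^n \text{ and } \frac{D(u^{n+1},u^n)}{\|v^{n+1}-v^n\|}<\delta\}$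 be the first index where $\delta\le d_{ME}(n)$ is violated. If $n_{ME}(\delta)\to\infty$ as $\delta\to 0$ and $\inf_{z^n\in H_n}\|A(z-z^n)\|\to 0$ as $n\to\infty$ for all $z\in H$, then $D(u^\dagger,u^{n_{ME}(\delta)})\to 0$ as $\delta\to 0$ subsequentially.
   Context: $H$ is a Hilbert space, $A:H\to c_0$ is linear and continuous, and $A^*:\ell^1\to H$ (using $c_0^*=\ell^1$) is its adjoint, which is weak*-to-weak continuous. Data $f^\delta\in H$ satisfy $\|f^\delta-f\|_H\leq\delta$. $(H_n)_n$ are subspaces of $H$ with $\dim H_n=n$, $P_n$ is the orthogonal projection onto $H_n$, and $P_nv\to v$ for every $v\in H$. It is assumed that $\mathcal N(A)\cap H_n=\{0\}$, that the equation $A^*u=f$ is solvable, and that for all $z\in H$, $\inf_{z^n\in H_n}\|A(z-z^n)\|\to 0$ as $n\to\infty$. The least error approximation is $u^n\in\operatorname{argmin}\{\|u\|_1:\ u\in\ell^1,\ P_nA^*u=P_nf^\delta\}$. For $\xi_v\in\partial\|\cdot\|_1(v)$ (i.e. $\|\xi_v\|_\infty\le1$, $\langle\xi_v,v\rangle=\|v\|_1$), the Bregman distance is $D(u,v)=\|u\|_1-\|v\|_1-\langle\xi_v,u-v\rangle=\|u\|_1-\langle\xi_v,u\rangle$.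
   Formalization: In (d), u† is additionally assumed to have minimal ℓ¹-norm among the solutions of A*u=f; for any other solution D(u†,u^n) ≥ ‖u†‖₁ − min‖u‖₁ > 0 and the convergence claim is false. Parts (a)–(c) hold for every solution. *)

(* Defs.v *)
From HB Require Import structures.
From mathcomp Require Import all_boot all_order all_algebra.
From mathcomp Require Import all_classical all_reals all_analysis.
Set Implicit Arguments. Unset Strict Implicit. Unset Printing Implicit Defensive.
Import Order.TTheory GRing.Theory Num.Theory.
Import numFieldNormedType.Exports.
Local Open Scope classical_set_scope.
Local Open Scope ring_scope.

Section Defs.
Variable R : realType.

Definition is_hilbert_ip (H : completeNormedModType R) (ip : H -> H -> R) : Prop :=
  [/\ (forall x y, ip x y = ip y x),
      (forall a x y z, ip (a *: x + y) z = a * ip x z + ip y z) &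
      (forall x, `|x| = Num.sqrt (ip x x))].

Definition is_c0 (x : nat -> R) : Prop := x @ \oo --> 0.
Definition is_l1 (u : nat -> R) : Prop := cvgn (series (fun k => `|u k|)).
Definition l1norm (u : nat -> R) : R := limn (series (fun k => `|u k|)).
Definition supnorm (x : nat -> R) : R := sup (range (fun k => `|x k|)).
(* duality pairing <xi, u> between l^infty (containing c_0) and l^1 *)
Definition pairing (xi u : nat -> R) : R := limn (series (fun k => xi k * u k)).

Definition subdiff_l1 (xi v : nat -> R) : Prop :=
  (forall k, `|xi k| <= 1) /\ pairing xi v = l1norm v.

Definition bregman (xi u v : nat -> R) : R :=
  l1norm u - l1norm v - pairing xi (fun k => u k - v k).

Variable H : completeNormedModType R.

Definition subspace_dim (S : set H) (n : nat) : Prop :=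
  exists b : 'I_n -> H,
    (forall c : 'I_n -> R, \sum_(i < n) c i *: b i = 0 -> forall i, c i = 0) /\
    S = [set x | exists c : 'I_n -> R, x = \sum_(i < n) c i *: b i].

Definition is_orth_proj (ip : H -> H -> R) (S : set H) (P : H -> H) : Prop :=
  forall v, S (P v) /\ forall w, S w -> ip (v - P v) w = 0.

Definition bounded_linear_to_c0 (A : H -> nat -> R) : Prop :=
  [/\ (forall a x y k, A (a *: x + y) k = a * A x k + A y k),
      (forall x, is_c0 (A x)) &
      (exists C : R, forall x k, `|A x k| <= C * `|x|)].

Definition is_adjoint (ip : H -> H -> R) (A : H -> nat -> R) (Astar : (nat -> R) -> H) :=
  forall u, is_l1 u -> forall z, ip (Astar u) z = pairing (A z) u.

Definition least_error_approx (Astar : (nat -> R) -> H) (P : H -> H) (g : H) (u : nat -> R) :=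
  [/\ is_l1 u, P (Astar u) = P g &
      forall w, is_l1 w -> P (Astar w) = P g -> l1norm u <= l1norm w].

Definition dME (ip : H -> H -> R) (g vn vn1 : H) : R :=
  if vn1 != vn then ip (vn1 - vn) g / `|vn1 - vn| else 0.

End Defs.

Section Defs2.
Variable R : realType.
Variable H : completeNormedModType R.
Definition ME_violated (A : H -> nat -> R) (ud : nat -> nat -> R) (vd : nat -> H)
  (delta : R) (m : nat) : Prop :=
  vd m.+1 != vd m /\
  bregman (A (vd m)) (ud m.+1) (ud m) / `|vd m.+1 - vd m| < delta.
End Defs2.

(* Main.v *)
(**
  Everything rests on duality for the problem of minimizing [|u|_1] under
  [<A z, u> = g z] for all [z] in a subspace [S].  If [g z <= M |A z|_oo] on
  [S], then [g] factors through [A] as a functional on part of [c_0]; extending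
  it by Hahn-Banach and reading off its values on the unit sequences gives a
  feasible [w] in [l^1] with [|w|_1 <= M].

  For [S = H_n] the dual problem [max { g z : |A z|_oo <= 1 }] is attained by
  compactness, since [A] is injective on [H_n], and a maximizer is the [v^n]
  of (a).  Parts (b) and (c) then follow from
  [D(udag, u^n) = |udag|_1 - <v^n, f>].

  For (d), fix [m].  Up to the stopping index the error decreases, so
  [D(udag, u^{n_ME}) <= D(udag, u^m) <= |udag|_1 - <z, f> + (C_m + |z|) delta]
  for each dual feasible [z] in [H_m], by weak duality.  Strong duality for
  [S = H] and the approximation property of [(H_n)] make [|udag|_1 - <z, f>]
  small; then [delta] tends to [0].  The whole sequence converges.
*)

Require Import Defs.
From HB Require Import structures.
From mathcomp Require Import all_boot all_order all_algebra.
From mathcomp Require Import all_classical all_reals all_analysis.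
From mathcomp Require Import lra.
Set Implicit Arguments.
Unset Strict Implicit.
Unset Printing Implicit Defensive.
Import Order.TTheory GRing.Theory Num.Theory.
Import numFieldNormedType.Exports.
Local Open Scope classical_set_scope.
Local Open Scope ring_scope.

(** * The Hahn-Banach theorem *)

Section HahnBanach.
Variables (R : realType) (V : lmodType R).
Implicit Types (p q : V -> R) (x y e : V).

Definition sublinear q :=
  (forall x y, q (x + y) <= q x + q y) /\
  (forall t x, 0 <= t -> q (t *: x) <= t * q x).

Lemma sublinear0 q : sublinear q -> q 0 = 0.
Proof.
move=> [qD qZ]; have := qZ 0 0 (lexx _); have := qD 0 0.
rewrite scale0r addr0 mul0r => h1 h2; lra.
Qed.

Lemma sublinearZ q t x : sublinear q -> 0 <= t -> q (t *: x) = t * q x.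
Proof.
move=> sq; rewrite le_eqVlt => /predU1P[<-|t0].
  by rewrite scale0r mul0r (sublinear0 sq).
apply/eqP; rewrite eq_le; apply/andP; split; first exact: (sq.2 _ _ (ltW t0)).
have /= := sq.2 t^-1 (t *: x); rewrite invr_ge0 => /(_ (ltW t0)).
by rewrite scalerA mulVf ?gt_eqF// scale1r mulrC ler_pdivlMr// mulrC.
Qed.

Lemma sublinear_oppr_le q x : sublinear q -> - q (- x) <= q x.
Proof.
by move=> sq; have := sq.1 x (- x); rewrite subrr (sublinear0 sq); lra.
Qed.

(** Every sublinear functional built below is an infimum of this kind: the shift, the lower bound of
    a chain, and the gauge of the moment problem. It suffices that the sets of values are stable
    under addition and scaling up to passing to a smaller element. *)
Lemma sublinear_inf (E : V -> set R) :
  (forall x, E x !=set0) -> (forall x, has_lbound (E x)) ->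
  (forall x y a b, E x a -> E y b -> exists2 c, E (x + y) c & c <= a + b) ->
  (forall t x a, 0 <= t -> E x a -> exists2 c, E (t *: x) c & c <= t * a) ->
  sublinear (fun x => inf (E x)).
Proof.
move=> E0 Elb ED EZ; split=> [x y|t x] /=.
  rewrite -lerBlDr; apply: lb_le_inf => // a Exa.
  rewrite lerBlDr [leRHS]addrC -lerBlDr; apply: lb_le_inf => // b Eyb.
  rewrite lerBlDr [leRHS]addrC; have [c Ec cab] := ED _ _ _ _ Exa Eyb.
  by apply: le_trans cab; apply: ge_inf.
rewrite le_eqVlt => /predU1P[<-|t0].
  have [a Exa] := E0 x; have [c Ec] := EZ 0 x a (lexx _) Exa.
  by rewrite !mul0r; apply: le_trans; apply: ge_inf.
rewrite mulrC -ler_pdivrMr//; apply: lb_le_inf => // a Exa.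
rewrite ler_pdivrMr// mulrC; have [c Ec] := EZ t x a (ltW t0) Exa.
by apply: le_trans; apply: ge_inf.
Qed.

(* A sublinear functional that is minimal is additive: comparing it with its
   modification [x |-> inf_(t >= 0) q (x + t e) - t q e] gives superadditivity. *)
Definition sublinear_shift q e x :=
  inf [set q (x + t *: e) - t * q e | t in [set t | 0 <= t]].

(** Since [t e = (x + t e) - x], subadditivity gives [t q e <= q (x + t e) + q (- x)], a bound
    uniform in [t]. *)
Lemma sublinear_shift_lb q e x : sublinear q ->
  has_lbound [set q (x + t *: e) - t * q e | t in [set t | 0 <= t]].
Proof.
move=> sq; exists (- q (- x)) => _ [t /= t0 <-].
have := sq.1 (x + t *: e) (- x); rewrite addrAC subrr add0r.
by rewrite (sublinearZ e sq t0); lra.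
Qed.

Lemma sublinear_shift_le q e x t : sublinear q -> 0 <= t ->
  sublinear_shift q e x <= q (x + t *: e) - t * q e.
Proof.
by move=> sq t0; apply: ge_inf; [exact: sublinear_shift_lb|exists t].
Qed.

Lemma sublinear_shift_sublinear q e : sublinear q ->
  sublinear (sublinear_shift q e).
Proof.
move=> sq; apply: sublinear_inf => [x|x|x y _ _ [t /= t0 <-] [s /= s0 <-]|].
- by exists (q (x + 0 *: e) - 0 * q e), 0 => /=.
- exact: sublinear_shift_lb.
- exists (q (x + y + (t + s) *: e) - (t + s) * q e).
    by exists (t + s) => //=; exact: addr_ge0.
  by rewrite scalerDl addrACA; have := sq.1 (x + t *: e) (y + s *: e); lra.
- move=> t x _ t0 [s /= s0 <-].
  exists (q (t *: x + (t * s) *: e) - t * s * q e).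
    by exists (t * s) => //=; exact: mulr_ge0.
  by rewrite -scalerA -scalerDr (sublinearZ _ sq t0); lra.
Qed.

(** Zorn's lemma for the reversed pointwise order. A chain is bounded by its pointwise infimum,
    which is finite because [- p (- x)] lies below every member. *)
Lemma minimal_sublinear p : sublinear p ->
  exists q, [/\ sublinear q, forall x, q x <= p x &
    forall q', sublinear q' -> (forall x, q' x <= q x) -> q' = q].
Proof.
move=> sp.
pose T := {q : V -> R | sublinear q /\ forall x, q x <= p x}.
pose le (a b : T) := `[< forall x, sval b x <= sval a x >].
have [|a b c /asboolP ab /asboolP bc|a b /asboolP ab /asboolP ba|C Ctot|m mP] :=
  @Zorn T le.
- by move=> a; apply/asboolP.
- by apply/asboolP => x; exact: le_trans (bc x) (ab x).
- case: a b ab ba => [q1 h1] [q2 h2] /= ab ba.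
  have e : q1 = q2 by apply/funext => x; apply/eqP; rewrite eq_le ab ba.
  by subst q2; congr exist; exact: Prop_irrelevance.
- have [->|/set0P[c0 Cc0]] := eqVneq C set0.
    by exists (exist _ p (conj sp (fun x => lexx _))).
  pose E x := [set sval c x | c in C].
  have Elb x : has_lbound (E x).
    exists (- p (- x)) => _ [c Cc <-]; apply: le_trans (sublinear_oppr_le _ (svalP c).1).
    by rewrite lerN2; exact: (svalP c).2.
  have sE : sublinear (fun x => inf (E x)).
    apply: sublinear_inf => // [x|x y _ _ [c Cc <-] [d Cd <-]|].
    + by exists (sval c0 x), c0.
    (* Subadditivity of the infimum needs the chain: of two members, the smaller one is evaluated at
       [x + y]. *)
    + have [/asboolP cd|/asboolP dc] := Ctot c d Cc Cd.
        exists (sval d (x + y)); first by exists d.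
        apply: le_trans ((svalP d).1.1 x y) _.
        by rewrite lerD2r.
      exists (sval c (x + y)); first by exists c.
      apply: le_trans ((svalP c).1.1 x y) _.
      by rewrite lerD2l.
    + move=> t x _ t0 [c Cc <-]; exists (sval c (t *: x)); first by exists c.
      exact: (svalP c).1.2.
  have Ep x : inf (E x) <= p x.
    apply: le_trans ((svalP c0).2 x); apply: ge_inf => //; by exists c0.
  exists (exist _ (fun x => inf (E x)) (conj sE Ep)) => c Cc.
  by apply/asboolP => x /=; apply: ge_inf => //; exists c.
- exists (sval m); split; [exact: (svalP m).1|exact: (svalP m).2|].
  move=> q' sq' q'm.
  have q'p x : q' x <= p x by apply: le_trans (q'm x) _; exact: (svalP m).2.
  have /mP/(congr1 sval) // : le m (exist _ q' (conj sq' q'p)) by apply/asboolP.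
Qed.

(** No functional on a subspace is prescribed; when the theorem is applied, the values to be
    extended are built into the gauge [p]. *)
Theorem hahn_banach p : sublinear p ->
  exists L : V -> R, [/\ forall x y, L (x + y) = L x + L y,
    forall t x, L (t *: x) = t * L x & forall x, L x <= p x].
Proof.
move=> /minimal_sublinear[q [sq qp qmin]].
have qD x y : q (x + y) = q x + q y.
  apply/eqP; rewrite eq_le; apply/andP; split; first exact: sq.1.
  have qy : sublinear_shift q y = q.
    apply: qmin => [|z]; first exact: sublinear_shift_sublinear.
    by have := sublinear_shift_le y z sq (lexx 0); rewrite scale0r addr0; lra.
  (* With [t = 1] the shift yields [q x <= q (x + y) - q y]. *)
  have := sublinear_shift_le y x sq ler01; rewrite qy scale1r; lra.
have qN x : q (- x) = - q x.
  by have := qD x (- x); rewrite subrr (sublinear0 sq); lra.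
exists q; split=> // t x.
have [t0|t0] := leP 0 t; first exact: sublinearZ.
rewrite -[t]opprK scaleNr qN sublinearZ ?mulNr//; lra.
Qed.

End HahnBanach.

(** * Summable sequences and the duality pairing *)

Section Pairing.
Variable R : realType.
Implicit Types (u w xi : nat -> R).

Lemma series_l1_le u n : is_l1 u -> \sum_(0 <= k < n) `|u k| <= l1norm u.
Proof.
move=> hu; have := nondecreasing_cvgn_le _ hu n; rewrite /series/=.
by apply; apply: nondecreasing_series.
Qed.

Lemma l1norm_ge0 u : is_l1 u -> 0 <= l1norm u.
Proof. by move=> /(series_l1_le 0); rewrite big_geq. Qed.

Lemma l1_bounded u M : (forall n, \sum_(0 <= k < n) `|u k| <= M) ->
  is_l1 u /\ l1norm u <= M.
Proof.
move=> uM; have hu : is_l1 u.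
  apply: nondecreasing_is_cvgn; first exact: nondecreasing_series.
  by exists M => _ [n _ <-]; exact: uM.
by split=> //; apply: limr_le => //; near=> n; exact: uM.
Unshelve. all: by end_near. Qed.

Lemma pairing_cvg xi u r : (forall k, `|xi k| <= r) -> is_l1 u ->
  series (fun k => xi k * u k) @ \oo --> pairing xi u.
Proof.
move=> xir hu; apply: normed_cvg.
apply: (@series_le_cvg _ _ (r *: (fun k => `|u k|))).
- by move=> k; exact: normr_ge0.
- move=> k; rewrite /GRing.scale/=; apply: mulr_ge0 => //.
  exact: le_trans (xir 0).
- by move=> k /=; rewrite normrM /GRing.scale/= ler_wpM2r.
- exact: is_cvg_seriesZ.
Qed.

Lemma pairing_le xi u r : (forall k, `|xi k| <= r) -> is_l1 u ->
  `|pairing xi u| <= r * l1norm u.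
Proof.
move=> xir hu; have r0 : 0 <= r by exact: le_trans (xir 0).
have hc := pairing_cvg xir hu.
rewrite ler_norml; apply/andP; split.
  apply: (limr_ge (cvgP _ hc)); near=> n.
  rewrite lerNl -sumrN (le_trans _ (ler_wpM2l r0 (series_l1_le n hu)))//.
  rewrite mulr_sumr; apply: ler_sum => k _.
  by rewrite (le_trans (ler_norm _))// normrN normrM ler_wpM2r.
apply: (limr_le (cvgP _ hc)); near=> n.
rewrite (le_trans _ (ler_wpM2l r0 (series_l1_le n hu)))//.
rewrite mulr_sumr; apply: ler_sum => k _.
by rewrite (le_trans (ler_norm _))// normrM ler_wpM2r.
Unshelve. all: by end_near. Qed.

Lemma pairingNl xi u r : (forall k, `|xi k| <= r) -> is_l1 u ->
  pairing (- xi) u = - pairing xi u.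
Proof.
move=> xir hu; apply: cvg_lim => //.
have -> : (fun k => (- xi) k * u k) = - (fun k => xi k * u k).
  by apply/funext => k; rewrite mulNr.
by rewrite seriesN; apply: cvgN; exact: pairing_cvg.
Qed.

Lemma c0_bounded xi : is_c0 xi -> exists r : R, forall k, `|xi k| <= r.
Proof.
move=> /cvgP/cvg_has_ub[r hr]; exists r => k.
by apply: hr; exists k.
Qed.

Lemma pairingB xi u w r : (forall k, `|xi k| <= r) -> is_l1 u -> is_l1 w ->
  pairing xi (fun k => u k - w k) = pairing xi u - pairing xi w.
Proof.
move=> xir hu hw; apply: cvg_lim => //.
have -> : (fun k => xi k * (u k - w k)) =
    (fun k => xi k * u k) - (fun k => xi k * w k).
  by apply/funext => k; rewrite mulrBr.
rewrite seriesD seriesN.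
by apply: cvgB; exact: pairing_cvg.
Qed.

Lemma bregmanE xi u w : is_l1 u -> is_l1 w -> subdiff_l1 xi w ->
  bregman xi u w = l1norm u - pairing xi u.
Proof.
by move=> hu hw [xi1 xiw]; rewrite /bregman (pairingB xi1)// xiw; lra.
Qed.

Lemma bregman_ge0 xi u w : is_l1 u -> is_l1 w -> subdiff_l1 xi w ->
  0 <= bregman xi u w.
Proof.
move=> hu hw xiw; rewrite bregmanE// subr_ge0 (le_trans (ler_norm _))//.
by have := pairing_le xiw.1 hu; rewrite mul1r.
Qed.

End Pairing.

(** * The dual problem *)

Section Moment.
Variables (R : realType) (V : lmodType R) (S : set V).
Variables (A : V -> nat -> R) (g : V -> R) (M : R).
Hypothesis S0 : S 0.
Hypothesis SP : forall t x y, S x -> S y -> S (t *: x + y).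
Hypothesis AP : forall t x y k, A (t *: x + y) k = t * A x k + A y k.
Hypothesis Ac0 : forall x, is_c0 (A x).
Hypothesis gP : forall t x y, g (t *: x + y) = t * g x + g y.
Hypothesis gM : forall z (r : R), S z -> (forall k, `|A z k| <= r) -> g z <= M * r.

Let g0 : g 0 = 0.
Proof. by have := gP 1 0 0; rewrite scale1r addr0; lra. Qed.

Let A0 k : A 0 k = 0.
Proof. by have := AP 1 0 0 k; rewrite scale1r addr0; lra. Qed.

Let M0 : 0 <= M.
Proof.
by have := @gM 0 1 S0; rewrite g0 mulr1; apply => k; rewrite A0 normr0.
Qed.

(* Finitely supported sequences, encoded as polynomials, are sent to their
   gauge relative to [M] times the supremum norm and the functional [g]. *)
Let E (s : {poly R}) := [set a | exists (z : V) (r : R),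
  [/\ S z, forall k, `|s`_k - A z k| <= r & a = M * r + g z]].

Let poly_bound (s : {poly R}) : exists B : R, forall k, `|s`_k| <= B.
Proof.
exists (\sum_(i < size s) `|s`_i|) => k.
have [ks|sk] := ltnP k (size s); last by rewrite nth_default// normr0 sumr_ge0.
by rewrite (bigD1 (Ordinal ks))//= lerDl sumr_ge0.
Qed.

(** If [s] is bounded by [B], then [A z] is bounded by [r + B], so [g (- z) <= M (r + B)] and
    [M r + g z >= - M B]. *)
Let E_lb s : has_lbound (E s).
Proof.
have [B hB] := poly_bound s; exists (- (M * B)).
move=> _ [z [r [Sz zr ->]]].
have Az k : `|A z k| <= r + B.
  rewrite (_ : A z k = s`_k - (s`_k - A z k)); last by lra.
  by rewrite (le_trans (ler_normB _ _))// addrC lerD.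
have SNz : S (- z) by have := @SP (-1) _ _ Sz S0; rewrite scaleN1r addr0.
have gN : g (- z) = - g z by have := gP (-1) z 0; rewrite g0 scaleN1r !addr0 mulN1r.
have AN k : A (- z) k = - A z k.
  by have := AP (-1) z 0 k; rewrite A0 scaleN1r !addr0 mulN1r.
have := @gM _ (r + B) SNz; rewrite gN => h.
have /h : forall k, `|A (- z) k| <= r + B by move=> k; rewrite AN normrN.
lra.
Qed.

Let sublinearE : sublinear (fun s => inf (E s)).
Proof.
apply: sublinear_inf => [s|//||].
- have [B hB] := poly_bound s.
  by exists (M * B + g 0), 0, B; split => // k; rewrite A0 subr0.
- move=> s t _ _ [z [r [Sz zr ->]]] [z' [r' [Sz' zr' ->]]].
  exists (M * (r + r') + g (1 *: z + z')); last by rewrite gP; lra.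
  exists (1 *: z + z'), (r + r'); split => //; first exact: SP.
  move=> k; rewrite coefD AP mul1r opprD addrACA (le_trans (ler_normD _ _))//.
  exact: lerD.
- move=> t s _ t0 [z [r [Sz zr ->]]].
  exists (M * (t * r) + g (t *: z + 0)); last by rewrite gP g0; lra.
  exists (t *: z + 0), (t * r); split => //; first exact: SP.
  move=> k; rewrite coefZ AP A0 addr0 -mulrBr normrM ger0_norm//.
  exact: ler_wpM2l.
Qed.

(** The gauge dominates a linear [L] on finitely supported sequences. Taking [z = 0] in the gauge
    bounds [L] by [M] times the supremum norm; taking [s] close to [A z] bounds [L s] by nearly
    [g z]. *)
Theorem l1_moment : exists w, [/\ is_l1 w, l1norm w <= M &
  forall z, S z -> pairing (A z) w = g z].
Proof.
have [L [LD LZ Lp]] := hahn_banach sublinearE.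
have LE (s : {poly R}) (z : V) (r : R) : S z -> (forall k, `|s`_k - A z k| <= r) -> L s <= M * r + g z.
  by move=> Sz zr; apply: le_trans (Lp s) _; apply: ge_inf => //; exists z, r.
have L0 : L 0 = 0 by have := LZ 0 0; rewrite scale0r mul0r.
pose w k := L 'X^k.
have Lpoly n (c : nat -> R) : L (\poly_(k < n) c k) = \sum_(0 <= k < n) c k * w k.
  rewrite poly_def big_mkord (big_morph L LD L0).
  by apply: eq_bigr => k _; rewrite LZ.
have [hw wM] : is_l1 w /\ l1norm w <= M.
  apply: l1_bounded => n.
  (* Testing [L] on the truncated sign sequence of [w] produces the partial sums of [|w k|]. *)
  have /(LE _ 0 1 S0) : forall k, `|(\poly_(k < n) Num.sg (w k))`_k - A 0 k| <= 1.
    move=> k; rewrite A0 subr0 coef_poly; case: ifP => _; last by rewrite normr0.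
    by rewrite normr_sg lern1 leq_b1.
  rewrite Lpoly g0 addr0 mulr1; apply: le_trans.
  by apply: ler_sum => k _; rewrite normrEsg.
exists w; split=> //.
have pairing_le_g z : S z -> pairing (A z) w <= g z.
  move=> Sz; apply/ler_addgt0Pr => e e0.
  have [r Azr] := c0_bounded (Ac0 z).
  have hc := pairing_cvg Azr hw.
  (* Truncations of [A z] approximate it uniformly because it lies in c_0. The summand [1] keeps the
     divisor positive when [M = 0]. *)
  have d0 : 0 < e / (M + 1) by rewrite divr_gt0// ltr_wpDl.
  apply: (limr_le (cvgP _ hc)).
  have /cvgr0_norm_le/(_ _ d0) [N _ hN] := Ac0 z.
  exists N => // n /= Nn.
  rewrite /series/= -Lpoly.
  have /(LE _ _ _ Sz) : forall k, `|(\poly_(k < n) A z k)`_k - A z k| <= e / (M + 1).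
    move=> k; rewrite coef_poly; case: ltnP => [_|nk].
      by rewrite subrr normr0 ltW.
    by rewrite sub0r normrN; apply: hN => /=; exact: leq_trans nk.
  move=> /le_trans; apply.
  rewrite addrC lerD2l mulrA ler_pdivrMr ?ltr_wpDl//.
  by rewrite mulrDr mulr1 mulrC lerDl ltW.
move=> z Sz; apply/eqP; rewrite eq_le pairing_le_g//=.
(* The reverse inequality is the one just proved, applied to [- z]. *)
have SNz : S (- z) by have := @SP (-1) _ _ Sz S0; rewrite scaleN1r addr0.
have gN : g (- z) = - g z.
  by have := gP (-1) z 0; rewrite g0 scaleN1r !addr0 mulN1r.
have AN : A (- z) = - A z.
  apply/funext => k; have := AP (-1) z 0 k.
  by rewrite A0 scaleN1r !addr0 mulN1r.
have [r Azr] := c0_bounded (Ac0 z).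
by have := pairing_le_g _ SNz; rewrite gN AN (pairingNl Azr)// lerN2.
Qed.

End Moment.

(** * Finite-dimensional subspaces *)

Section FiniteDim.
Variables (R : realType) (H : completeNormedModType R).
Variables (A : H -> nat -> R) (n : nat) (b : 'I_n -> H).
Hypothesis AP : forall t x y k, A (t *: x + y) k = t * A x k + A y k.
Hypothesis b_free : forall c : 'I_n -> R,
  \sum_(i < n) c i *: b i = 0 -> forall i, c i = 0.
Hypothesis A_inj : forall c : 'I_n -> R,
  (forall k, A (\sum_(i < n) c i *: b i) k = 0) -> \sum_(i < n) c i *: b i = 0.

Let A0 k : A 0 k = 0.
Proof. by have := AP 1 0 0 k; rewrite scale1r addr0; lra. Qed.

Let A_sum (c : 'I_n -> R) k : A (\sum_(i < n) c i *: b i) k = \sum_(i < n) c i * A (b i) k.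
Proof.
have AD x y : A (x + y) k = A x k + A y k.
  by have := AP 1 x y k; rewrite scale1r mul1r.
rewrite (big_morph (A ^~ k) AD (A0 k)); apply: eq_bigr => i _.
by have := AP (c i) (b i) 0 k; rewrite A0 !addr0.
Qed.

Let a N : 'M[R]_(n, N) := \matrix_(i, k) A (b i) k.

Let mul_a N (c : 'rV[R]_n) (k : 'I_N) :
  (c *m a N) 0 k = A (\sum_(i < n) c 0 i *: b i) k.
Proof. by rewrite A_sum mxE; apply: eq_bigr => i _; rewrite mxE. Qed.

Let kermx_a_le N N' : (N <= N')%N -> (kermx (a N') <= kermx (a N))%MS.
Proof.
move=> NN'; apply/sub_kermxP/row_matrixP => i; rewrite row_mul row0.
apply/rowP => k; rewrite mul_a mxE -(mul_a _ (widen_ord NN' k)).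
by rewrite -row_mul mulmx_ker row0 mxE.
Qed.

(* The rank of the first [N] columns is maximal for some [N], after which the
   left kernel no longer shrinks; what it contains is annihilated by [A]. *)
Lemma truncation_row_free : exists N, row_free (a N).
Proof.
pose P r := `[< exists N, \rank (a N) = r >].
have exP : exists r, P r by exists (\rank (a 0)); apply/asboolP; exists 0%N.
have leP r : P r -> (r <= n)%N by move=> /asboolP[N <-]; exact: rank_leq_row.
case: (ex_maxnP exP leP) => r /asboolP[N aN] rmax.
exists N; apply: inj_row_free => c ca.
have cker : (c <= kermx (a N))%MS by apply/sub_kermxP.
suff Ac0 k : A (\sum_(i < n) c 0 i *: b i) k = 0.
  by apply/rowP => i; rewrite mxE; apply: (b_free (A_inj Ac0)).
have NN' := leq_maxl N k.+1; have kN' : (k < maxn N k.+1)%N := leq_maxr N k.+1.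
rewrite -[k]/(nat_of_ord (Ordinal kN')) -mul_a.
suff /(submx_trans cker)/sub_kermxP -> :
  (kermx (a N) <= kermx (a (maxn N k.+1)))%MS by rewrite mxE.
(* One inclusion of the kernels is known; by maximality of the rank their dimensions agree, so they
   coincide. *)
rewrite -(geq_leqif (mxrank_leqif_sup (kermx_a_le NN'))) !mxrank_ker aN.
by apply: leq_sub2l; apply: rmax; apply/asboolP; exists (maxn N k.+1).
Qed.

(** A right inverse [B] of an injective truncation recovers [c] from finitely many entries of the
    image under [A], each at most 1 in absolute value. Hence the absolute column sums of [B] serve
    as bounds. *)
Lemma coord_bounded : exists C : 'I_n -> R, (forall i, 0 <= C i) /\
  forall c : 'I_n -> R, (forall k, `|A (\sum_(i < n) c i *: b i) k| <= 1) ->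
  forall i, `|c i| <= C i.
Proof.
have [N /row_freeP[B aB]] := truncation_row_free.
exists (fun i => \sum_(k < N) `|B k i|); split=> [i|c Ac1 i].
  by apply: sumr_ge0.
have -> : c i = \sum_(k < N) A (\sum_(i < n) c i *: b i) k * B k i.
  pose v : 'rV[R]_n := \row_j c j.
  have -> : c i = (v *m a N *m B) 0 i by rewrite -mulmxA aB mulmx1 mxE.
  rewrite mxE; apply: eq_bigr => k _; rewrite mul_a; congr (A _ _ * _).
  by apply: eq_bigr => j _; rewrite mxE.
rewrite (le_trans (ler_norm_sum _ _ _))//; apply: ler_sum => k _.
by rewrite normrM ler_piMl.
Qed.

Lemma unit_preimage_bounded : exists C : R, forall c : 'I_n -> R,
  (forall k, `|A (\sum_(i < n) c i *: b i) k| <= 1) ->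
  `|\sum_(i < n) c i *: b i| <= C.
Proof.
have [C [C0 hC]] := coord_bounded.
exists (\sum_(i < n) C i * `|b i|) => c /hC cC.
rewrite (le_trans (ler_norm_sum _ _ _))//; apply: ler_sum => i _.
by rewrite normrZ ler_wpM2r.
Qed.

Lemma linear_form_continuous (d : 'I_n -> R) :
  continuous (fun c : 'rV[R]_n => \sum_(i < n) c 0 i * d i).
Proof.
apply: continuous_big => [|i _ c]; first exact: add_continuous.
exact: (cvgM (@coord_continuous R 1 n 0 i c) (cvg_cst (d i))).
Qed.

(** The admissible coordinate vectors form a compact set: bounded by [coord_bounded], and closed as
    an intersection of preimages of intervals. A linear form attains its maximum there. *)
Lemma unit_preimage_max (g : H -> R) :
  (forall t x y, g (t *: x + y) = t * g x + g y) ->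
  exists c : 'I_n -> R, (forall k, `|A (\sum_(i < n) c i *: b i) k| <= 1) /\
  forall c' : 'I_n -> R, (forall k, `|A (\sum_(i < n) c' i *: b i) k| <= 1) ->
  g (\sum_(i < n) c' i *: b i) <= g (\sum_(i < n) c i *: b i).
Proof.
move=> gP.
have g0 : g 0 = 0 by have := gP 1 0 0; rewrite scale1r addr0; lra.
have g_sum (c : 'I_n -> R) : g (\sum_(i < n) c i *: b i) = \sum_(i < n) c i * g (b i).
  have gD x y : g (x + y) = g x + g y by have := gP 1 x y; rewrite scale1r mul1r.
  rewrite (big_morph g gD g0); apply: eq_bigr => i _.
  by have := gP (c i) (b i) 0; rewrite g0 !addr0.
pose K := [set c : 'rV[R]_n | forall k, `|\sum_(i < n) c 0 i * A (b i) k| <= 1].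
have K0 : K !=set0.
  exists 0 => k; rewrite big1 ?normr0// => i _; by rewrite mxE mul0r.
have cK : compact K.
  apply: bounded_closed_compact.
    have [C [C0 hC]] := coord_bounded.
    exists (\sum_i C i); split => [|x Cx c Kc]; first exact: num_real.
    have {}hC i : `|c 0 i| <= C i.
      by apply: (hC (fun i => c 0 i)) => k; rewrite A_sum; exact: Kc.
    have x0 : 0 <= x by apply: le_trans (ltW Cx); exact: sumr_ge0.
    rewrite /= [leLHS]/Num.norm/= mx_normrE; apply: bigmax_le => //= -[i j] _ /=.
    rewrite ord1 (le_trans (hC j))// (le_trans _ (ltW Cx))//.
    by rewrite (bigD1 j)//= lerDl sumr_ge0.
  rewrite (_ : K = \bigcap_k
    ((fun c : 'rV[R]_n => \sum_(i < n) c 0 i * A (b i) k) @^-1` [set t | `|t| <= 1])).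
    apply: closed_bigI => k _; apply: preimage_closed.
      by move=> c _; exact: linear_form_continuous.
    rewrite (_ : mkset _ = Num.norm @^-1` [set t | t <= 1])//.
    by apply: preimage_closed => [t _|]; [exact: norm_continuous|exact: closed_le].
  by apply/seteqP; split => [c Kc k _|c Kc k]; [exact: Kc|exact: Kc].
have gc : {within K, continuous (fun c : 'rV[R]_n => \sum_(i < n) c 0 i * g (b i))}.
  by apply: continuous_subspaceT; exact: linear_form_continuous.
have [c] := EVT_max_rV K0 cK gc; rewrite inE => Kc cmax.
exists (fun i => c 0 i); split => [k|c' Kc']; first by rewrite A_sum; exact: Kc.
have := cmax (\row_i c' i); rewrite !g_sum inE.
have e (d : 'I_n -> R) : \sum_(i < n) (\row_j c' j) 0 i * d i = \sum_(i < n) c' i * d i.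
  by apply: eq_bigr => i _; rewrite mxE.
rewrite !e; apply => k; rewrite e -A_sum; exact: Kc'.
Qed.

End FiniteDim.

Section Subspaces.
Variables (R : realType) (H : completeNormedModType R).

Lemma subspace_dim0 (S : set H) n : subspace_dim S n -> S 0.
Proof.
move=> [b [_ ->]]; exists (fun=> 0).
by rewrite big1// => i _; rewrite scale0r.
Qed.

Lemma subspace_dimP (S : set H) n t x y :
  subspace_dim S n -> S x -> S y -> S (t *: x + y).
Proof.
move=> [b [_ ->]] [c ->] [d ->]; exists (fun i => t * c i + d i).
rewrite scaler_sumr -big_split/=; apply: eq_bigr => i _.
by rewrite scalerDl scalerA.
Qed.

End Subspaces.

(** * Inner product identities and the Cauchy-Schwarz inequality *)

Section InnerProduct.
Variables (R : realType) (H : completeNormedModType R) (ip : H -> H -> R).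
Hypothesis hip : is_hilbert_ip ip.

Lemma ipC x y : ip x y = ip y x. Proof. by have [] := hip. Qed.

Lemma ipP a x y z : ip (a *: x + y) z = a * ip x z + ip y z.
Proof. by have [_ + _] := hip; apply. Qed.

Lemma ip0l z : ip 0 z = 0.
Proof. by have := ipP 1 0 0 z; rewrite scale1r addr0; lra. Qed.

Lemma ipZl a x z : ip (a *: x) z = a * ip x z.
Proof. by have := ipP a x 0 z; rewrite ip0l !addr0. Qed.

Lemma ipBl x y z : ip (x - y) z = ip x z - ip y z.
Proof. by have := ipP (-1) y x z; rewrite scaleN1r addrC => ->; lra. Qed.

Lemma ipBr x y z : ip x (y - z) = ip x y - ip x z.
Proof. by rewrite ipC ipBl !(ipC _ x). Qed.

(** Positivity is derived: if [ip x x] were negative, its square root would be 0 by convention,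
    forcing [x = 0]. *)
Lemma ipxx x : ip x x = `|x| ^+ 2.
Proof.
have [_ _ hn] := hip; have [x0|x0] := leP 0 (ip x x).
  by rewrite hn sqr_sqrtr.
have : `|x| = 0 by rewrite hn ltr0_sqrtr.
by move/normr0_eq0 => ->; rewrite ip0l normr0 expr0n.
Qed.

Lemma ip_cauchy_schwarz x y : ip x y <= `|x| * `|y|.
Proof.
have [->|x0] := eqVneq x 0; first by rewrite ip0l normr0 mul0r.
have [->|y0] := eqVneq y 0; first by rewrite ipC ip0l normr0 mulr0.
have : 0 <= ip (`|y| *: x - `|x| *: y) (`|y| *: x - `|x| *: y).
  by rewrite ipxx exprn_ge0.
rewrite !(ipBl, ipBr) !ipZl !(ipC _ (_ *: _)) !ipZl (ipC y x) !ipxx.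
have : 0 < `|x| * `|y| by rewrite mulr_gt0 ?normr_gt0.
set s := `|x|; set t := `|y|; set c := ip x y => st0 h.
(* The expanded square equals [2 s t (s t - c)]. *)
have {}h : 0 <= (s * t) * (s * t - c) by lra.
by rewrite -subr_ge0 -(pmulr_rge0 _ st0).
Qed.

Lemma ip_eq x y : (forall z, ip x z = ip y z) -> x = y.
Proof.
move=> h; apply/eqP; rewrite -subr_eq0 -normr_eq0 -sqrf_eq0 -ipxx.
by rewrite ipBl h subrr.
Qed.

End InnerProduct.

(** * Least error approximations *)

Section LeastError.
Variables (R : realType) (H : completeNormedModType R) (ip : H -> H -> R).
Variables (A : H -> nat -> R) (Astar : (nat -> R) -> H).
Hypothesis hip : is_hilbert_ip ip.
Hypothesis hA : bounded_linear_to_c0 A.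
Hypothesis hAs : is_adjoint ip A Astar.

Let AP t x y k : A (t *: x + y) k = t * A x k + A y k.
Proof. by have [+ _ _] := hA; apply. Qed.

Let Ac0 x : is_c0 (A x).
Proof. by have [_ + _] := hA; apply. Qed.

Let A0 k : A 0 k = 0.
Proof. by have := AP 1 0 0 k; rewrite scale1r addr0; lra. Qed.

Let AZ t x k : A (t *: x) k = t * A x k.
Proof. by have := AP t x 0 k; rewrite A0 !addr0. Qed.

Let AB x y k : A (x - y) k = A x k - A y k.
Proof. by have := AP (-1) y x k; rewrite scaleN1r addrC => ->; lra. Qed.

(** The bound on the unit ball of [|A z|] rescales to any radius [r > 0]; radius 0 is covered by the
    separate condition on the kernel of [A]. *)
Lemma l1_dual (S : set H) (g : H) (M : R) : S 0 ->
  (forall t x y, S x -> S y -> S (t *: x + y)) ->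
  (forall z, S z -> (forall k, A z k = 0) -> ip z g <= 0) ->
  (forall z, S z -> (forall k, `|A z k| <= 1) -> ip z g <= M) ->
  exists w, [/\ is_l1 w, l1norm w <= M &
    forall z, S z -> ip z (Astar w) = ip z g].
Proof.
move=> S0 SP Sker S1.
have gP t x y : ip (t *: x + y) g = t * ip x g + ip y g by exact: ipP.
have gM z (r : R) : S z -> (forall k, `|A z k| <= r) -> ip z g <= M * r.
  move=> Sz Azr; have : 0 <= r by exact: le_trans (Azr 0%N).
  rewrite le_eqVlt => /predU1P[r0|r0].
    rewrite -r0 mulr0; apply: Sker => // k; apply/eqP.
    by rewrite -normr_le0 r0.
  rewrite -ler_pdivrMr// mulrC -(ipZl hip); apply: S1.
    by have := SP r^-1 z 0 Sz S0; rewrite addr0.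
  by move=> k; rewrite AZ normrM gtr0_norm ?invr_gt0// mulrC ler_pdivrMr// mul1r.
have [w [hw wM Aw]] := l1_moment S0 SP AP Ac0 gP gM.
by exists w; split=> // z Sz; rewrite (ipC hip) (hAs hw); exact: Aw.
Qed.

Section Subspace.
Variables (S : set H) (n : nat) (P : H -> H).
Hypothesis hS : subspace_dim S n.
Hypothesis hP : is_orth_proj ip S P.
Hypothesis A_inj : forall x, S x -> (forall k, A x k = 0) -> x = 0.

Let S0 : S 0 := subspace_dim0 hS.

Let SP t x y : S x -> S y -> S (t *: x + y) := @subspace_dimP R H S n t x y hS.

(** Turns the projected equation into the linear constraints on which the duality argument
    operates. *)
Lemma orth_proj_eqP x y : P x = P y <-> forall z, S z -> ip z x = ip z y.
Proof.
have ipPz w z : S z -> ip z (P w) = ip z w.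
  by move=> Sz; have [_ /(_ z Sz)] := hP w; rewrite (ipC hip) (ipBr hip); lra.
split=> [e z Sz|e]; first by rewrite -ipPz// e ipPz.
have Sd : S (P x - P y).
  by have := SP (-1) (hP y).1 (hP x).1; rewrite scaleN1r addrC.
apply/eqP; rewrite -subr_eq0 -normr_eq0 -sqrf_eq0 -(ipxx hip) (ipBr hip).
by rewrite !ipPz// e// subrr.
Qed.

Lemma least_error_feasible g u z : least_error_approx Astar P g u -> S z ->
  pairing (A z) u = ip z g.
Proof.
by move=> [hu /orth_proj_eqP e _] Sz; rewrite -(hAs hu) (ipC hip) e.
Qed.

Lemma least_error_ge g u z : least_error_approx Astar P g u -> S z ->
  (forall k, `|A z k| <= 1) -> ip z g <= l1norm u.
Proof.
move=> hu Sz Az; rewrite -(least_error_feasible hu Sz) -[leRHS]mul1r.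
by apply: le_trans (ler_norm _) _; apply: pairing_le => //; have [] := hu.
Qed.

(** Take [v] maximizing [ip v g] over the dual feasible set. Duality gives a feasible [w] of norm at
    most [ip v g], so minimality of [u] gives one inequality and weak duality the other. *)
Lemma exists_dual_certificate g u : least_error_approx Astar P g u ->
  exists v, S v /\ subdiff_l1 (A v) u.
Proof.
move=> hu; have [b [b_free Sb]] := hS.
have bS (c : 'I_n -> R) : S (\sum_(i < n) c i *: b i) by rewrite Sb; exists c.
have A_injb (c : 'I_n -> R) : (forall k, A (\sum_(i < n) c i *: b i) k = 0) ->
    \sum_(i < n) c i *: b i = 0 by exact: A_inj.
have gP t x y : ip (t *: x + y) g = t * ip x g + ip y g by exact: ipP.
have [c [Ac1 cmax]] := unit_preimage_max AP b_free A_injb gP.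
set v := \sum_(i < n) c i *: b i in Ac1 cmax.
have [z Sz Az|z|w [hw wM Aw]] := @l1_dual S g (ip v g) S0 (fun t x y => @SP t x y).
- by rewrite (A_inj Sz Az) (ip0l hip).
- by rewrite Sb => -[c' ->]; exact: cmax.
exists v; split; first exact: bS.
split=> //; apply/eqP; rewrite eq_le; apply/andP; split.
  by rewrite (least_error_feasible hu (bS c)); exact: least_error_ge.
rewrite (least_error_feasible hu (bS c)); apply: le_trans wM.
by have [_ _ +] := hu; apply => //; apply/orth_proj_eqP.
Qed.

(** The constant depends on the subspace only, hence serves all noise levels at once in the
    convergence proof. *)
Lemma certificate_bounded : exists C : R, forall v, S v ->
  (forall k, `|A v k| <= 1) -> `|v| <= C.
Proof.
have [b [b_free Sb]] := hS.
have bS (c : 'I_n -> R) : S (\sum_(i < n) c i *: b i) by rewrite Sb; exists c.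
have A_injb (c : 'I_n -> R) : (forall k, A (\sum_(i < n) c i *: b i) k = 0) ->
    \sum_(i < n) c i *: b i = 0 by exact: A_inj.
have [C hC] := unit_preimage_bounded AP b_free A_injb.
by exists C => v; rewrite Sb => -[c ->]; exact: hC.
Qed.

End Subspace.

(* Strong duality for the exact problem, with the dual variable ranging over
   the whole Hilbert space, where the supremum need not be attained. *)
Lemma min_norm_dual f udag e : is_l1 udag -> Astar udag = f ->
  (forall w, is_l1 w -> Astar w = f -> l1norm udag <= l1norm w) -> 0 < e ->
  exists z, (forall k, `|A z k| <= 1) /\ l1norm udag - e <= ip z f.
Proof.
move=> hu uf umin e0; apply: contrapT => /forallNP noz.
(* If all dual values stayed below [l1norm udag - e], duality would produce a solution of norm at
   most that number, against minimality. *)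
have [//|//|z _ Az|z _ Az|w [hw wM Aw]] := @l1_dual setT f (l1norm udag - e).
- rewrite -uf (ipC hip) (hAs hu).
  rewrite (le_trans (ler_norm _))// -(mul0r (l1norm udag)).
  by apply: pairing_le => // k; rewrite Az normr0.
- have := noz z; apply: contra_notP => /negP.
  by rewrite -ltNge => /ltW.
- have /(umin _ hw) : Astar w = f.
    by apply: (ip_eq hip) => z; rewrite !(ipC hip _ z); exact: Aw.
  lra.
Qed.

(* Density of the subspaces in the norm [|A _|] moves an almost optimal dual
   variable into one of them, at the price of a rescaling. *)
Lemma min_norm_dual_approx (Hn : nat -> set H) f udag e :
  (forall n, Hn n 0) ->
  (forall n t x y, Hn n x -> Hn n y -> Hn n (t *: x + y)) ->
  (forall z, (fun n => inf [set supnorm (A (z - w)) | w in Hn n]) @ \oo --> (0 : R)) ->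
  is_l1 udag -> Astar udag = f ->
  (forall w, is_l1 w -> Astar w = f -> l1norm udag <= l1norm w) -> 0 < e ->
  exists m z, [/\ Hn m z, forall k, `|A z k| <= 1 & l1norm udag - e <= ip z f].
Proof.
move=> Hn0 HnP happ hu uf umin e0.
have e2 : 0 < e / 2 by lra.
have [z [Az1 zf]] := min_norm_dual hu uf umin e2.
set N := l1norm udag in zf *; have N0 : 0 <= N by exact: l1norm_ge0.
(* Replacing [z] by [w] loses at most [eta N <= e / 4] in the dual value, and dividing by [1 + eta]
   costs at most another [e / 4]; the first [e / 2] is the duality gap at [z]. *)
pose eta := e / (4 * (N + 1)).
have N4 : 0 < 4 * (N + 1) by lra.
have eta0 : 0 < eta by rewrite divr_gt0.
have etaN : eta * N <= e / 4.
  rewrite /eta mulrAC ler_pdivrMr//; nra.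
have [m [w [Hw Azw]]] : exists m w, Hn m w /\ forall k, `|A (z - w) k| <= eta.
  have /cvgrPdist_lt/(_ _ eta0) [m _ /(_ m (leqnn m))] := happ z.
  set E := [set _ | _ in _]; rewrite /= sub0r normrN => infE.
  have : inf E < eta by apply: le_lt_trans infE; exact: ler_norm.
  have E0 : E !=set0 by exists (supnorm (A (z - 0))), 0.
  move=> /(inf_lt E0) [_ [w Hw <-] sw].
  exists m, w; split=> // k; apply: le_trans (ltW sw); apply: ub_le_sup; last by exists k.
  have [r Ar] := c0_bounded (Ac0 (z - w)).
  by exists r => _ [j _ <-]; exact: Ar.
have eta1 : 0 < 1 + eta by lra.
exists m, ((1 + eta)^-1 *: w); split.
- by have := HnP m (1 + eta)^-1 w 0 Hw (Hn0 m); rewrite addr0.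
- move=> k; rewrite AZ normrM gtr0_norm ?invr_gt0// mulrC ler_pdivrMr// mul1r.
  rewrite (_ : A w k = A z k - A (z - w) k); last by rewrite AB; lra.
  by rewrite (le_trans (ler_normB _ _))// lerD.
- rewrite (ipZl hip) mulrC ler_pdivlMr//.
  have : ip (z - w) f <= eta * N.
    rewrite -uf (ipC hip) (hAs hu) (le_trans (ler_norm _))//.
    exact: pairing_le.
  rewrite (ipBl hip); nra.
Qed.

End LeastError.

(** * Monotonicity of the error *)

Section NoisyData.
Variables (R : realType) (H : completeNormedModType R) (ip : H -> H -> R).
Variables (A : H -> nat -> R) (Astar : (nat -> R) -> H).
Variables (Hn : nat -> set H) (P : nat -> H -> H).
Variables (f : H) (udag : nat -> R).
Hypothesis hip : is_hilbert_ip ip.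
Hypothesis hA : bounded_linear_to_c0 A.
Hypothesis hAs : is_adjoint ip A Astar.
Hypothesis hdim : forall n, subspace_dim (Hn n) n.
Hypothesis hP : forall n, is_orth_proj ip (Hn n) (P n).
Hypothesis hudag : is_l1 udag.
Hypothesis hf : Astar udag = f.
Variables (delta : R) (fd : H) (u : nat -> nat -> R) (v : nat -> H).
Hypothesis hfd : `|fd - f| <= delta.
Hypothesis hu : forall n, least_error_approx Astar (P n) fd (u n).
Hypothesis hv : forall n, Hn n (v n) /\ subdiff_l1 (A (v n)) (u n).

Let ul1 n : is_l1 (u n). Proof. by have [] := hu n. Qed.

Let D n := bregman (A (v n)) udag (u n).

Lemma least_error_norm n : l1norm (u n) = ip (v n) fd.
Proof.
have [Hv [_ <-]] := hv n.
exact: (least_error_feasible hip hAs (hdim n) (hP n) (hu n)).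
Qed.

Lemma bregman_udag n : D n = l1norm udag - ip (v n) f.
Proof.
by rewrite /D bregmanE//; [rewrite -(hAs hudag) hf (ipC hip)|exact: (hv n).2].
Qed.

(** For nested subspaces, [u n.+1] satisfies the constraints of level [n] and competes in that
    minimization. *)
Lemma least_error_norm_le n : Hn n `<=` Hn n.+1 ->
  l1norm (u n) <= l1norm (u n.+1).
Proof.
move=> sub; have [_ _] := hu n; apply; first exact: ul1.
apply/(orth_proj_eqP hip (hdim n) (hP n)) => z Hz.
have [_ /(orth_proj_eqP hip (hdim n.+1) (hP n.+1)) e _] := hu n.+1.
by apply: e; exact: sub.
Qed.

(** The value 0 chosen for equal certificates makes this product formula hold without a case
    distinction. *)
Lemma dME_mul n :
  dME ip fd (v n) (v n.+1) * `|v n.+1 - v n| = ip (v n.+1 - v n) fd.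
Proof.
rewrite /dME; have [->|ne] := eqVneq (v n.+1) (v n).
  by rewrite subrr (ip0l hip) mul0r.
by rewrite divfK// normr_eq0 subr_eq0.
Qed.

(** The increment is [- ip (v n.+1 - v n) f]. Replacing [f] by [fd] leaves an error that
    Cauchy-Schwarz bounds by [delta] times the length of the step. *)
Lemma bregman_succ_le n :
  D n.+1 - D n <= - (dME ip fd (v n) (v n.+1) - delta) * `|v n.+1 - v n|.
Proof.
rewrite !bregman_udag mulNr mulrBl dME_mul.
have := ip_cauchy_schwarz hip (v n.+1 - v n) (fd - f).
have := ler_wpM2l (normr_ge0 (v n.+1 - v n)) hfd.
rewrite (ipBr hip) !(ipBl hip); lra.
Qed.

Lemma dME_norm n : v n.+1 != v n -> dME ip fd (v n) (v n.+1) =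
  (l1norm (u n.+1) - l1norm (u n)) / `|v n.+1 - v n|.
Proof.
by move=> ne; rewrite /dME ne (ipBl hip) -!least_error_norm.
Qed.

(** Nestedness puts [v n] in the next subspace, where [u n.+1] reproduces the data. *)
Lemma bregman_succ n : Hn n `<=` Hn n.+1 ->
  bregman (A (v n)) (u n.+1) (u n) = ip (v n.+1 - v n) fd.
Proof.
move=> sub; rewrite bregmanE//; last exact: (hv n).2.
rewrite (ipBl hip) least_error_norm; congr (_ - _).
apply: (least_error_feasible hip hAs (hdim n.+1) (hP n.+1) (hu n.+1)).
by apply: sub; exact: (hv n).1.
Qed.

Lemma dME_bregman n : Hn n `<=` Hn n.+1 -> dME ip fd (v n) (v n.+1) =
  bregman (A (v n)) (u n.+1) (u n) / `|v n.+1 - v n|.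
Proof.
move=> sub; rewrite bregman_succ// /dME; have [->|//] := eqVneq (v n.+1) (v n).
by rewrite subrr (ip0l hip) mul0r.
Qed.

Lemma dME_ge0 n : Hn n `<=` Hn n.+1 -> 0 <= dME ip fd (v n) (v n.+1).
Proof.
move=> sub; rewrite dME_bregman//; apply: divr_ge0 => //.
by apply: bregman_ge0 => //; exact: (hv n).2.
Qed.

Lemma bregman_decreasing n : delta <= dME ip fd (v n) (v n.+1) -> D n.+1 <= D n.
Proof.
move=> h; rewrite -subr_le0; apply: le_trans (bregman_succ_le n) _.
by rewrite mulNr oppr_le0 mulr_ge0// subr_ge0.
Qed.

Lemma bregman_le_before_violation m N :
  (forall n, Hn n `<=` Hn n.+1) ->
  (forall n, ME_violated A u v delta n -> (N <= n)%N) ->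
  (m <= N)%N -> D N <= D m.
Proof.
move=> sub hN mN.
have step n : (n < N)%N -> D n.+1 <= D n.
  (* An index with equal certificates never counts as a violation, but [D] depends on [n] only
     through [v n], so it does not change there. *)
  move=> nN; have [e|ne] := eqVneq (v n.+1) (v n).
    by rewrite !bregman_udag e.
  apply: bregman_decreasing; rewrite leNgt; apply/negP => viol.
  have /hN : ME_violated A u v delta n by split=> //; rewrite -dME_bregman.
  by rewrite leqNgt nN.
have le_add k : (m + k <= N)%N -> D (m + k) <= D m.
  elim: k => [|k IH] kN; first by rewrite addn0.
  by rewrite addnS in kN *; apply: le_trans (IH (ltnW kN)); exact: step.
by rewrite -{1}(subnKC mN); apply: le_add; rewrite subnKC.
Qed.

(* Weak duality against a fixed [z] in [Hn m] bounds the error at step [m]. *)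
Lemma bregman_le_dual C m z : Hn m z -> (forall k, `|A z k| <= 1) ->
  `|v m| <= C -> D m <= l1norm udag - ip z f + (C + `|z|) * delta.
Proof.
move=> Hz Az vC; rewrite bregman_udag.
have d0 : 0 <= delta by exact: le_trans hfd.
have := least_error_ge hip hAs (hdim m) (hP m) (hu m) Hz Az.
rewrite least_error_norm => zfd.
(* The noise enters twice: in passing from [f] to [fd] at [v m], and back to [f] at [z]. *)
have h1 : ip (v m) (fd - f) <= C * delta.
  by rewrite (le_trans (ip_cauchy_schwarz hip _ _))// ler_pM.
have h2 : ip z (f - fd) <= `|z| * delta.
  by rewrite (le_trans (ip_cauchy_schwarz hip _ _))// distrC ler_pM.
move: h1 h2; rewrite !(ipBr hip) mulrDl; lra.
Qed.

End NoisyData.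

Theorem theorem2 (R : realType) (H : completeNormedModType R) (ip : H -> H -> R)
  (A : H -> nat -> R) (Astar : (nat -> R) -> H) (Hn : nat -> set H) (P : nat -> H -> H)
  (f : H) (udag : nat -> R)
  (hip : is_hilbert_ip ip)
  (hA : bounded_linear_to_c0 A)
  (hAs : is_adjoint ip A Astar)
  (hdim : forall n, subspace_dim (Hn n) n)
  (hP : forall n, is_orth_proj ip (Hn n) (P n))
  (hPcv : forall v, (fun n => P n v) @ \oo --> v)
  (hN : forall n x, Hn n x -> (forall k, A x k = 0) -> x = 0)
  (happrox : forall z : H,
     (fun n => inf [set supnorm (A (z - w)) | w in Hn n]) @ \oo --> (0 : R))
  (hudag : is_l1 udag /\ Astar udag = f) :
  (* parts (a)-(c), for fixed noise level delta and data fd *)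
  (forall (delta : R) (fd : H) (u : nat -> nat -> R),
     `|fd - f| <= delta ->
     (forall n, least_error_approx Astar (P n) fd (u n)) ->
     (* (a) *)
     (forall n, exists vn, Hn n vn /\ subdiff_l1 (A vn) (u n)) /\
     forall v : nat -> H, (forall n, Hn n (v n) /\ subdiff_l1 (A (v n)) (u n)) ->
       (* (b) *)
       (forall n, l1norm (u n) = ip (v n) fd) /\
       (forall n, Hn n `<=` Hn n.+1 -> l1norm (u n) <= l1norm (u n.+1)) /\
       (* (c) *)
       (forall n, bregman (A (v n.+1)) udag (u n.+1) - bregman (A (v n)) udag (u n)
                  <= - (dME ip fd (v n) (v n.+1) - delta) * `|v n.+1 - v n|) /\
       (forall n, v n.+1 != v n ->
          dME ip fd (v n) (v n.+1) = (l1norm (u n.+1) - l1norm (u n)) / `|v n.+1 - v n|) /\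
       (forall n, Hn n `<=` Hn n.+1 ->
          [/\ dME ip fd (v n) (v n.+1)
                = bregman (A (v n)) (u n.+1) (u n) / `|v n.+1 - v n|,
              0 <= dME ip fd (v n) (v n.+1) &
              delta <= dME ip fd (v n) (v n.+1) ->
                bregman (A (v n.+1)) udag (u n.+1) <= bregman (A (v n)) udag (u n)]))
  /\
  (* part (d): data fd delta, approximations u delta n, v delta n, for delta > 0 *)
  (forall (fd : R -> H) (u : R -> nat -> nat -> R) (v : R -> nat -> H) (nME : R -> nat),
     (forall n, Hn n `<=` Hn n.+1) ->
     (forall w, is_l1 w -> Astar w = f -> l1norm udag <= l1norm w) ->
     (forall delta, 0 < delta -> `|fd delta - f| <= delta) ->
     (forall delta n, 0 < delta -> least_error_approx Astar (P n) (fd delta) (u delta n)) ->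
     (forall delta n, 0 < delta ->
        Hn n (v delta n) /\ subdiff_l1 (A (v delta n)) (u delta n)) ->
     (forall delta, 0 < delta ->
        ME_violated A (u delta) (v delta) delta (nME delta) /\
        forall m, ME_violated A (u delta) (v delta) delta m -> (nME delta <= m)%N) ->
     (forall N : nat, \forall delta \near 0^'+, (N <= nME delta)%N) ->
     (forall z : H,
        (fun n => inf [set supnorm (A (z - w)) | w in Hn n]) @ \oo --> (0 : R)) ->
     forall ds : nat -> R, (forall k, 0 < ds k) -> ds @ \oo --> (0 : R) ->
       exists phi : nat -> nat, {homo phi : m n / (m < n)%N} /\
         (fun j => bregman (A (v (ds (phi j)) (nME (ds (phi j)))))
                           udag (u (ds (phi j)) (nME (ds (phi j))))) @ \oo --> (0 : R)).
Proof.
have [ul1 uf] := hudag; split.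
  move=> delta fd u hfd hu; split=> [n|v hv].
    exact: (exists_dual_certificate hip hA hAs (hdim n) (hP n) (hN n) (hu n)).
  split; first exact: (least_error_norm hip hAs hdim hP hu hv).
  split; first exact: (least_error_norm_le hip hdim hP hu).
  split; first exact: (bregman_succ_le hip hAs ul1 uf hfd hu hv).
  split; first exact: (dME_norm hip hAs hdim hP hu hv).
  move=> n sub; split.
  - exact: (dME_bregman hip hAs hdim hP hu hv sub).
  - exact: (dME_ge0 hip hAs hdim hP hu hv sub).
  - exact: (bregman_decreasing hip hAs ul1 uf hfd hu hv).
move=> fd u v nME sub umin hfd hu hv hME nMEoo _ ds ds0 dscv.
exists id; split=> //.
have Hn0 n := subspace_dim0 (hdim n).
have HnP n t x y := @subspace_dimP _ _ _ _ t x y (hdim n).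
apply/cvgr0Pnorm_le => e e0.
(* Half of [e] is spent on the duality gap; the other half is left for the noise term. Both [m] and
   [z] are fixed before [delta] becomes small. *)
have [|m [z [Hz Az zf]]] := @min_norm_dual_approx R H ip A Astar hip hA hAs
  Hn f udag (e / 2) Hn0 HnP happrox ul1 uf umin; first by lra.
have [C hC] := certificate_bounded hA (hdim m) (hN m).
have C0 : 0 <= C.
  have [Hv [Av _]] := hv _ m (ds0 0%N).
  exact: le_trans (normr_ge0 _) (hC _ Hv Av).
(* Below this threshold [(C + |z|) delta] is at most [e / 2]; the added [1] keeps the divisor
   positive. *)
have eta0 : 0 < e / 2 / (C + `|z| + 1).
  by rewrite !divr_gt0// ltr_wpDl// addr_ge0.
have [r /= r0 rnME] := nMEoo m.
near=> j.
have dj : ds j < r by near: j; exact: (cvgr_lt 0 dscv).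
have dje : ds j < e / 2 / (C + `|z| + 1).
  by near: j; exact: (cvgr_lt 0 dscv).
have mj : (m <= nME (ds j))%N.
  by apply: rnME => //=; rewrite sub0r normrN gtr0_norm.
have [_ hmin] := hME _ (ds0 j).
have hvj n := hv _ n (ds0 j).
have huj n := hu _ n (ds0 j).
rewrite ger0_norm; last first.
  by apply: bregman_ge0 => //; [have [] := huj (nME (ds j))|exact: (hvj _).2].
apply: le_trans (bregman_le_before_violation hip hAs hdim hP ul1 uf (hfd _ (ds0 j))
  huj hvj sub hmin mj) _.
apply: le_trans (bregman_le_dual hip hAs hdim hP ul1 uf (hfd _ (ds0 j)) huj hvj
  Hz Az (hC _ (hvj m).1 (hvj m).2.1)) _.
move: dje; rewrite ltr_pdivlMr ?ltr_wpDl ?addr_ge0// => dje.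
have := ds0 j; nra.
Unshelve. all: by end_near. Qed.
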